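(* Let $U,V$ be finite sets and let $\rho$ be a probability distribution on $U\times V$ that is not a product distribution (i.e. $\rho\neq\rho_U\otimes\rho_V$, where $\rho_U,\rho_V$ are the marginals of $\rho$). For $n\in\mathbb{N}$ let $\mathit{EQ}_n\colon\{0,1\}^n\times\{0,1\}^n\to\{0,1\}$ be the equality function, $\mathit{EQ}_n(x,y)=1$ if $x=y$ and $\mathit{EQ}_n(x,y)=0$ otherwise. Then $\mathit{SMP}_\rho(\mathit{EQ}_n)=O(1)$, where the implied constant depends only on $\rho$ and not on $n$; that is, there is a constant $C_\rho$ with $\mathit{SMP}_\rho(\mathit{EQ}_n)\le C_\rho$ for all $n$.
   Context: SMP model with source $\rho$. A protocol for a function $f$ on $\{0,1\}^n\times\{0,1\}^n$ fixes a number $\ell\in\mathbb{N}$ of independent samples $(u_1,v_1),\dots,(u_\ell,v_\ell)\sim\rho$. Alice receives her input $x$ and $(u_1,\dots,u_\ell)$; Bob receives his input $y$ and $(v_1,\dots,v_\ell)$. Each of them sends a single message, depending only on what they received, to a referee, who sees only the two messages and outputs an answer. (Players and referee may also use private independent randomness.) The protocol has error probability $\delta$ if for every input $(x,y)$ in the domain of $f$ the answer equals $f(x,y)$ with probability at least $1-\delta$. The cost of the protocol is the maximum possible total number of bits sent by Alice and Bob. $\mathit{SMP}_\rho(f)$ is the minimum cost of a protocol with source $\rho$ that solves $f$ with error probability less than $1/3$. *)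

(* Defs.v *)
From HB Require Import structures.
From mathcomp Require Import all_boot all_order all_algebra.
From mathcomp Require Import all_classical all_reals ereal.

Set Implicit Arguments.
Unset Strict Implicit.
Unset Printing Implicit Defensive.

Import Order.TTheory GRing.Theory Num.Theory.
Local Open Scope ring_scope.

Record fdist (R : realType) (T : finType) := FDist {
  fdist_fun :> T -> R ;
  fdist_ge0 : forall t, 0 <= fdist_fun t ;
  fdist_sum1 : \sum_t fdist_fun t = 1 }.

Section Marginals.
Variables (R : realType) (U V : finType) (rho : fdist R (U * V)%type).

Definition marginal1 (u : U) : R := \sum_v rho (u, v).
Definition marginal2 (v : V) : R := \sum_u rho (u, v).

Definition is_product : Prop :=
  forall u v, rho (u, v) = marginal1 u * marginal2 v.

End Marginals.

(* The private coins of Alice, Bob and the referee are three independent finite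
   probability spaces.  Finiteness loses nothing: inputs, samples and messages
   range over finite sets, so any private randomness only matters through the
   conditional distributions it induces on messages and answers, and these can
   be realised by finite spaces.  Messages are bit strings, whose length may
   depend on what the sender received. *)
Record protocol (R : realType) (U V X Y : finType) := Protocol {
  samples : nat ;
  coinsA : finType ;
  coinsB : finType ;
  coinsR : finType ;
  distA : fdist R coinsA ;
  distB : fdist R coinsB ;
  distR : fdist R coinsR ;
  alice : X -> {ffun 'I_samples -> U} -> coinsA -> bitseq ;
  bob : Y -> {ffun 'I_samples -> V} -> coinsB -> bitseq ;
  referee : bitseq -> bitseq -> coinsR -> bool }.

Section SMP.
Variables (R : realType) (U V X Y : finType) (rho : fdist R (U * V)%type).
Implicit Types (p : protocol R U V X Y) (f : X -> Y -> bool).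

Definition msgA p x (w : {ffun 'I_(samples p) -> U * V}) (a : coinsA p) :=
  alice x [ffun i => (w i).1] a.

Definition msgB p y (w : {ffun 'I_(samples p) -> U * V}) (b : coinsB p) :=
  bob y [ffun i => (w i).2] b.

(* Worst case over all inputs, samples and coins, including outcomes of
   probability zero. *)
Definition cost p : nat :=
  \max_(x : X) \max_(y : Y) \max_(w : {ffun 'I_(samples p) -> U * V})
    \max_(a : coinsA p) \max_(b : coinsB p)
      (size (msgA x w a) + size (msgB y w b))%N.

Definition prob_answer p (x : X) (y : Y) (z : bool) : R :=
  \sum_(w : {ffun 'I_(samples p) -> U * V})
    \sum_(a : coinsA p) \sum_(b : coinsB p) \sum_(c : coinsR p
        | referee (msgA x w a) (msgB y w b) c == z)
      (\prod_i rho (w i)) * distA p a * distB p b * distR p c.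

Definition has_error p f (delta : R) : Prop :=
  forall x y, 1 - delta <= prob_answer p x y (f x y).

Definition solves p f : Prop := exists2 delta : R, delta < 3^-1 & has_error p f delta.

(* The infimum of a set of natural numbers is attained when the set is
   nonempty; it is +oo when no protocol solves f. *)
Definition SMP f : \bar R :=
  ereal_inf [set c : \bar R | exists2 p, solves p f & c = (cost p)%:R%:E]%classic.

End SMP.

Definition EQ (n : nat) (x y : n.-tuple bool) : bool := x == y.

(* Main.v *)
(** With one sample per input, no encoding is needed: index the samples by
    pairs (j, z) with j < m and z an n-bit string.  On input x Alice reports,
    for every j, whether u_(j,x) is a fixed letter u0, and on input y Bob
    reports whether v_(j,y) is v0.  The pairs (u_(j,x), v_(j,y)) are m
    independent draws from rho if x = y, and from the product of the marginals
    if x <> y.  When (u0, v0) is a pair on which these two distributions differ,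
    Chebyshev's inequality lets the referee tell them apart for some m that
    depends only on rho. *)
Require Import Defs.
From HB Require Import structures.
From mathcomp Require Import all_boot all_order all_algebra.
From mathcomp Require Import all_classical all_reals ereal.
From mathcomp Require Import ring lra.

Set Implicit Arguments.
Unset Strict Implicit.
Unset Printing Implicit Defensive.

Import Order.TTheory GRing.Theory Num.Theory.
Local Open Scope ring_scope.

(** * Expectation over independent samples and the variance of a count *)

Section IidExpectation.
Variables (R : realType) (I T : finType) (rho : fdist R T).
Implicit Types F G : {ffun I -> T} -> R.

Definition iid_weight (w : {ffun I -> T}) : R := \prod_i rho (w i).

Definition iid_expect F : R := \sum_w iid_weight w * F w.

Lemma iid_weight_ge0 w : 0 <= iid_weight w.
Proof. by apply: prodr_ge0 => i _; apply: fdist_ge0. Qed.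

Lemma iid_expect_prod (h : I -> T -> R) :
  iid_expect (fun w => \prod_i h i (w i)) = \prod_i \sum_t rho t * h i t.
Proof.
by rewrite bigA_distr_bigA; apply: eq_bigr => w _; rewrite -big_split.
Qed.

(** The indicator of a conjunction is a product of indicators, one per sample, so independence
    factors its expectation. *)
Lemma iid_expect_forall (h : I -> pred T) :
  iid_expect (fun w => [forall i, h i (w i)]%:R) =
  \prod_i \sum_(t | h i t) rho t.
Proof.
transitivity (\prod_i \sum_t rho t * (h i t)%:R).
  rewrite -(iid_expect_prod (fun i t => (h i t)%:R)).
  apply: eq_bigr => w _; congr (_ * _).
  case: forallP => [hw|/forallP/forallPn[i /negPf hwi]].
    by rewrite big1 // => i _; rewrite hw.
  by rewrite (bigD1 i) //= hwi mul0r.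
apply: eq_bigr => i _; rewrite [RHS]big_mkcond.
by apply: eq_bigr => t _; case: (h i t); rewrite ?mulr1 ?mulr0.
Qed.

Lemma iid_expectD F G :
  iid_expect (fun w => F w + G w) = iid_expect F + iid_expect G.
Proof. by rewrite -big_split; apply: eq_bigr => w _; rewrite mulrDr. Qed.

Lemma iid_expectZ c F : iid_expect (fun w => c * F w) = c * iid_expect F.
Proof.
by rewrite /iid_expect big_distrr; apply: eq_bigr => w _; rewrite mulrCA.
Qed.

Lemma iid_expect_cst c : iid_expect (fun=> c) = c.
Proof.
rewrite /iid_expect -big_distrl /= /iid_weight.
rewrite -(bigA_distr_bigA (fun _ t => rho t)) big1 ?mul1r // => i _.
exact: fdist_sum1.
Qed.

Lemma iid_expect_sum (J : finType) (F : J -> {ffun I -> T} -> R) :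
  iid_expect (fun w => \sum_j F j w) = \sum_j iid_expect (F j).
Proof.
by rewrite /iid_expect exchange_big; apply: eq_bigr => w _; rewrite big_distrr.
Qed.

Lemma eq_iid_expect F G : F =1 G -> iid_expect F = iid_expect G.
Proof. by move=> FG; apply: eq_bigr => w _; rewrite FG. Qed.

Lemma ler_iid_expect F G :
  (forall w, F w <= G w) -> iid_expect F <= iid_expect G.
Proof.
by move=> FG; apply: ler_sum => w _; rewrite ler_wpM2l ?iid_weight_ge0.
Qed.

(** By pairwise independence the count has variance [m * (r - r ^+ 2)]; the bound is made uniform in
    [r], since [r] will depend on the inputs. *)
Lemma iid_expect_sqr_dev_le m (r : R) (X : 'I_m -> {ffun I -> T} -> bool) :
  (forall j, iid_expect (fun w => (X j w)%:R) = r) ->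
  (forall j k, j != k ->
     iid_expect (fun w => (X j w && X k w)%:R) = r ^+ 2) ->
  iid_expect (fun w => ((\sum_j X j w)%:R - m%:R * r) ^+ 2) <= m%:R / 4.
Proof.
move=> EX EXX.
pose K w : R := (\sum_j X j w)%:R.
have EK : iid_expect K = m%:R * r.
  under eq_iid_expect do rewrite /K natr_sum.
  by rewrite iid_expect_sum (eq_bigr _ (fun j _ => EX j)) sumr_const card_ord
    mulr_natl.
have EK2 : iid_expect (fun w => K w ^+ 2) =
    m%:R * (r - r ^+ 2) + m%:R ^+ 2 * r ^+ 2.
  (* The diagonal value [r] is split as [(r - r ^+ 2) + r ^+ 2], so that [r ^+ 2] occurs in all
     terms. *)
  transitivity (\sum_(j < m) \sum_(k < m)
      ((if k == j then r - r ^+ 2 else 0) + r ^+ 2)).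
    under eq_iid_expect do rewrite /K natr_sum expr2 big_distrlr /=.
    rewrite iid_expect_sum; apply: eq_bigr => j _.
    rewrite iid_expect_sum; apply: eq_bigr => k _.
    under eq_iid_expect do rewrite -natrM mulnb.
    have [->|neq_kj] := eqVneq k j.
      by under eq_iid_expect do rewrite andbb; rewrite EX subrK.
    by rewrite EXX ?add0r // eq_sym.
  under eq_bigr => j _.
    rewrite big_split /= -big_mkcond big_pred1_eq sumr_const card_ord.
    over.
  by rewrite sumr_const card_ord -[LHS]mulr_natl -[r ^+ 2 *+ m]mulr_natl; ring.
under eq_iid_expect => w.
  rewrite -/(K w).
  have -> : (K w - m%:R * r) ^+ 2 =
      K w ^+ 2 + ((- 2 * m%:R * r) * K w + (m%:R * r) ^+ 2) by ring.
  over.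
rewrite !iid_expectD iid_expectZ iid_expect_cst EK EK2.
(* Completing the square: [r - r ^+ 2 = 1/4 - (r - 1/2) ^+ 2]. *)
have : 0 <= m%:R * (r - 2^-1) ^+ 2 :> R by rewrite mulr_ge0 ?sqr_ge0 ?ler0n.
by lra.
Qed.

End IidExpectation.

(** * The protocol that counts joint hits, its cost and its error *)

Section FrequencyProtocol.
Variables (R : realType) (U V X : finType) (rho : fdist R (U * V)%type).
Variables (u0 : U) (v0 : V) (m : nat).

Let n_samples := #|{: 'I_m * X}|.

Lemma big_unit (P : pred unit) (F : unit -> R) :
  \sum_(t | P t) F t = if P tt then F tt else 0.
Proof. by rewrite big_mkcond (big_pred1 tt) // => -[]. Qed.

Lemma unit_dist_sum1 : \sum_(t : unit) (1 : R) = 1.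
Proof. exact: big_unit. Qed.

Definition unit_dist : fdist R unit :=
  FDist (fun=> ler01 : (0 : R) <= 1) unit_dist_sum1.

Definition hits (W : eqType) (w0 : W) (z : X) (w : {ffun 'I_n_samples -> W}) :
  bitseq := [seq w (enum_rank (j, z)) == w0 | j <- enum 'I_m].

Lemma size_hits (W : eqType) (w0 : W) z w : size (hits w0 z w) = m.
Proof. by rewrite size_map size_enum_ord. Qed.

Lemma nth_hits (W : eqType) (w0 : W) z w (j : 'I_m) :
  nth false (hits w0 z w) j = (w (enum_rank (j, z)) == w0).
Proof. by rewrite (nth_map j) ?size_enum_ord // nth_ord_enum. Qed.

(** The default [false] only makes this total on bit strings; messages of the protocol have length
    [m]. *)
Definition joint_hits (s t : bitseq) : nat :=
  (\sum_(j < m) (nth false s j && nth false t j))%N.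

Let p := rho (u0, v0).
Let q := marginal1 rho u0 * marginal2 rho v0.

(** The number of samples grows with [X], but samples are free: only the message lengths are
    charged. The players and the referee are deterministic, hence the one-point coin spaces. *)
Definition frequency_protocol : protocol R U V X X :=
  @Protocol R U V X X n_samples unit unit unit unit_dist unit_dist unit_dist
    (fun x u _ => hits u0 x u) (fun y v _ => hits v0 y v)
    (fun s t _ => `|(joint_hits s t)%:R - m%:R * p| <
                  `|(joint_hits s t)%:R - m%:R * q|).

Lemma cost_frequency_protocol : (cost frequency_protocol <= m + m)%N.
Proof.
apply/bigmax_leqP => x _; apply/bigmax_leqP => y _; apply/bigmax_leqP => w _.
apply/bigmax_leqP => a _; apply/bigmax_leqP => b _.
by rewrite !size_hits.
Qed.

Section FixedInputs.
Variables x y : X.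

Let hit j (w : {ffun 'I_n_samples -> U * V}) : bool :=
  ((w (enum_rank (j, x))).1 == u0) && ((w (enum_rank (j, y))).2 == v0).

(** What a hit in round [j] demands of the sample indexed by [(j, z)]; it is vacuous unless [z] is
    [x] or [y]. This turns a hit into one condition per sample. *)
Let accepted z (t : U * V) : bool :=
  ((z == x) ==> (t.1 == u0)) && ((z == y) ==> (t.2 == v0)).

Let r := if x == y then p else q.

(** If [x = y], one sample is constrained in both coordinates; otherwise two distinct samples are
    constrained in one coordinate each, which yields the marginals. All other factors are 1. *)
Lemma prod_accepted : \prod_z \sum_(t | accepted z t) rho t = r.
Proof.
rewrite /r /accepted (bigD1 x) //= eqxx /=.
have [<-|neq_xy] := eqVneq x y.
  rewrite (big_pred1 (u0, v0)) => [|[u v]] //.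
  rewrite big1 ?mulr1 // => z /negPf ->.
  by rewrite -(fdist_sum1 rho); apply: eq_bigl.
rewrite (bigD1 y) 1?eq_sym //= eqxx (negPf neq_xy) /=.
rewrite [X in _ * (_ * X)]big1 ?mulr1; last first.
  move=> z /andP[/negPf -> /negPf ->].
  by rewrite -(fdist_sum1 rho); apply: eq_bigl.
congr (_ * _).
  transitivity (\sum_(u | u == u0) \sum_v rho (u, v)); last exact: big_pred1_eq.
  by rewrite pair_big; apply: eq_big => -[u v] //=; rewrite !andbT.
transitivity (\sum_u \sum_(v | v == v0) rho (u, v)); last first.
  by apply: eq_bigr => u _; apply: big_pred1_eq.
by rewrite pair_big; apply: eq_big => -[u v].
Qed.

(** Different rounds use disjoint samples. Singletons [J] will give the mean of a hit, and
    two-element sets the pairwise independence. *)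
Lemma iid_expect_hits (J : {set 'I_m}) :
  iid_expect rho (fun w => [forall j in J, hit j w]%:R) = r ^+ #|J|.
Proof.
pose h (i : 'I_n_samples) t :=
  ((enum_val i).1 \in J) ==> accepted (enum_val i).2 t.
transitivity (iid_expect rho
    (fun w : {ffun 'I_n_samples -> _} => [forall i, h i (w i)]%:R)).
  apply: eq_iid_expect => w; congr (_%:R); congr (nat_of_bool _).
  apply/forall_inP/forallP => [hitJ i|hw j jJ].
    apply/implyP => iJ; have /andP[hx hy] := hitJ _ iJ.
    by apply/andP; split; apply/implyP => /eqP Dz;
      [move: hx|move: hy]; rewrite -Dz -surjective_pairing enum_valK.
  have := hw (enum_rank (j, x)); have := hw (enum_rank (j, y)).
  rewrite /h !enum_rankK /= jJ /= /accepted !eqxx /=.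
  by case/andP=> _ hy /andP[hx _]; apply/andP.
(* Passing from sample indices to pairs [(j, z)] lets the product split by rounds. *)
rewrite iid_expect_forall (reindex enum_rank) /=; last first.
  exact: onW_bij (enum_rank_bij _).
transitivity (\prod_(j : 'I_m) \prod_(z : X)
    \sum_(t | (j \in J) ==> accepted z t) rho t).
  by rewrite pair_big; apply: eq_bigr => -[j z] _; rewrite /h enum_rankK.
rewrite -prodr_const [RHS]big_mkcond; apply: eq_bigr => j _.
case: (j \in J); first exact: prod_accepted.
by rewrite big1 // => z _; rewrite -(fdist_sum1 rho).
Qed.

Lemma iid_expect_hits_dev :
  iid_expect rho (fun w => ((\sum_j hit j w)%:R - m%:R * r) ^+ 2) <= m%:R / 4.
Proof.
apply: iid_expect_sqr_dev_le => [j|j k neq_jk].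
  rewrite -[RHS]expr1 -(cards1 j) -iid_expect_hits.
  apply: eq_iid_expect => w; congr (_%:R); congr (nat_of_bool _).
  apply/idP/forall_inP => [hj k|]; last by apply; rewrite set11.
  by rewrite inE => /eqP ->.
have <- : #|[set j; k]| = 2%N by rewrite cards2 neq_jk.
rewrite -iid_expect_hits.
apply: eq_iid_expect => w; congr (_%:R); congr (nat_of_bool _).
apply/andP/forall_inP => [[hj hk] l|h].
  by rewrite !inE => /orP[] /eqP ->.
by split; apply: h; rewrite !inE eqxx ?orbT.
Qed.

Lemma prob_answer_frequency_protocol z :
  prob_answer rho frequency_protocol x y z =
  iid_expect rho (fun w =>
    ((`|(\sum_j hit j w)%:R - m%:R * p| < `|(\sum_j hit j w)%:R - m%:R * q|)
      == z)%:R).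
Proof.
apply: eq_bigr => w _.
do 3!(etransitivity; first exact: big_unit); rewrite /=.
have -> : joint_hits (msgA (p := frequency_protocol) x w tt)
                     (msgB (p := frequency_protocol) y w tt) =
          (\sum_j hit j w)%N.
  apply: eq_bigr => j _.
  by rewrite !nth_hits !ffunE.
by rewrite /= !mulr1; case: ifP => _; rewrite ?mulr1 ?mulr0.
Qed.

(** Chebyshev: a wrong answer puts the count at distance at least [m * |p - q| / 2] from its mean
    [m * r]. *)
Lemma prob_answer_frequency_protocol_ge :
  (0 < m)%N -> p != q ->
  1 - (m%:R * (p - q) ^+ 2)^-1 <=
    prob_answer rho frequency_protocol x y (x == y).
Proof.
move=> m_gt0 neq_pq; rewrite prob_answer_frequency_protocol.
have m_gt0R : 0 < m%:R :> R by rewrite ltr0n.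
have d_gt0 : 0 < (p - q) ^+ 2 by rewrite exprn_even_gt0 //= subr_eq0.
(* Scaled so that [c * dev w] is at least 1 whenever the answer is wrong; hence [1 - c * dev w] is a
   pointwise lower bound for the indicator of a correct answer. *)
pose c := 4 / (m%:R ^+ 2 * (p - q) ^+ 2).
have c_ge0 : 0 <= c by rewrite divr_ge0 // mulr_ge0 ?sqr_ge0.
pose dev w := ((\sum_j hit j w)%:R - m%:R * r) ^+ 2.
apply: (@le_trans _ _ (iid_expect rho (fun w => 1 + - c * dev w))).
  rewrite iid_expectD iid_expect_cst iid_expectZ lerD2l mulNr lerN2.
  apply: (le_trans (ler_wpM2l c_ge0 iid_expect_hits_dev)).
  rewrite le_eqVlt; apply/orP; left; apply/eqP.
  by rewrite /c; field; rewrite subr_eq0 neq_pq lt0r_neq0.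
apply: ler_iid_expect => w.
have dev_ge0 : 0 <= dev w by apply: sqr_ge0.
case: eqP => [_|/eqP wrong] /=.
  by rewrite gerDl mulNr oppr_le0 mulr_ge0.
rewrite mulNr subr_le0.
suff: (m%:R * (p - q)) ^+ 2 <= 4 * dev w.
  move=> le_dev; rewrite /c mulrAC ler_pdivlMr ?mul1r -?exprMn //.
  by rewrite exprMn mulr_gt0 ?d_gt0 ?exprn_gt0.
move: wrong; rewrite /dev /r.
set k := (\sum_j hit j w)%:R; set a := k - m%:R * p; set b := k - m%:R * q.
rewrite -ltr_sqr ?nnegrE // !real_normK ?num_real //.
have -> : m%:R * (p - q) = b - a by rewrite /a /b; ring.
have ab_ge0 := sqr_ge0 (a + b).
(* So [(b - a) ^+ 2] is at most 4 times the larger of the two squares, which is [dev w] when the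
   answer is wrong. *)
have -> : (b - a) ^+ 2 = 2 * a ^+ 2 + 2 * b ^+ 2 - (a + b) ^+ 2 by ring.
by case: (x == y); rewrite ?eqb_id ?eqbF_neg ?negbK -?leNgt -/a -/b; lra.
Qed.

End FixedInputs.

End FrequencyProtocol.

Theorem theorem1p5 (R : realType) (U V : finType) (rho : fdist R (U * V)%type)
    (rho_not_product : ~ is_product rho) :
  exists C : R, forall n : nat, (SMP rho (@EQ n) <= C%:E)%E.
Proof.
have /existsNP[u0 /existsNP[v0 /eqP neq_pq]] := rho_not_product.
set p := rho (u0, v0) in neq_pq; set q := _ * _ in neq_pq.
have d_gt0 : 0 < (p - q) ^+ 2 by rewrite exprn_even_gt0 //= subr_eq0.
(* Then [m * (p - q) ^+ 2] exceeds 4, so the error is at most 1/4, below 1/3, and [m] does not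
   involve [n]. *)
pose m := (Num.truncn (4 / (p - q) ^+ 2)).+1.
exists (m + m)%:R => n.
pose P := frequency_protocol (n.-tuple bool) rho u0 v0 m.
apply: (@le_trans _ _ (cost P)%:R%:E).
  apply: ereal_inf_lbound; exists P => //.
  exists 4^-1; first by lra.
  move=> x y; apply: le_trans (prob_answer_frequency_protocol_ge _ _ _ _) => //.
  rewrite lerD2l lerN2 lef_pV2 ?posrE ?(mulr_gt0 _ d_gt0) ?ltr0n //.
  by rewrite -ler_pdivrMr // ltW // truncnS_gt.
by rewrite lee_fin ler_nat cost_frequency_protocol.
Qed.
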